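(* Let $G$ be a connected graph and let $a,b$ be two distinct vertices of $G$. Then $G$ admits a $\{1,2,4\}$-Hamiltonian path from $a$ to $b$ if and only if $G$ is not a bistar centered at $a$ and $b$.
   Context: All graphs are finite, simple, undirected, without self-loops and non-empty. A bistar centered at vertices $a$ and $b$ is a graph in which $a$ and $b$ are adjacent, every vertex other than $a,b$ is adjacent to exactly one of $a$ and $b$ and to no other vertex, and both $a$ and $b$ have degree at least $2$. A walk of length $k$ is a sequence of vertices $(u_0,\dots,u_k)$ with consecutive vertices adjacent; vertices may repeat. For $S \subseteq \mathbb{N}^+$, an $S$-Hamiltonian path of $G$ is a sequence $(v_1,\dots,v_n)$ listing every vertex of $G$ exactly once such that for each $i<n$ the vertices $v_i,v_{i+1}$ are joined by a walk in $G$ whose length lies in $S$; it is from $a$ to $b$ if $v_1=a$ and $v_n=b$. *)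

(* Defs.v *)
From mathcomp Require Import all_boot.

Set Implicit Arguments.
Unset Strict Implicit.
Unset Printing Implicit Defensive.

(* A finite simple graph is a symmetric and irreflexive edge relation [e]
   on a finite type [T] of vertices. *)
Section Graph.
Variables (T : finType) (e : rel T).

Definition connected_graph : Prop := forall x y, connect e x y.

Definition deg (x : T) : nat := #|[set y | e x y]|.

(* A walk (u_0, ..., u_k) is given by u_0 and the sequence [p] of the
   remaining k vertices. *)
Definition walk (k : nat) (x y : T) : Prop :=
  exists p : seq T, [/\ size p = k, path e x p & last x p = y].

(* The path is [x :: p], so the i-th step goes from [nth x (x :: p) i] to
   [nth x p i]; the default [x] is never reached. *)
Definition hamiltonian_path (S : {pred nat}) (x : T) (p : seq T) : Prop :=
  [/\ uniq (x :: p), forall v, v \in x :: p &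
      forall i, i < size p ->
        exists2 k, k \in S & walk k (nth x (x :: p) i) (nth x p i)].

Definition has_hamiltonian_path (S : {pred nat}) (a b : T) : Prop :=
  exists2 p : seq T, hamiltonian_path S a p & last a p = b.

(* [(+)] is exclusive or. *)
Definition bistar (a b : T) : Prop :=
  [/\ e a b,
      forall v, v != a -> v != b ->
        e v a (+) e v b /\ (forall w, e v w -> w = a \/ w = b),
      2 <= deg a & 2 <= deg b].

End Graph.

(* Main.v *)
(** Sufficiency is by strong induction on a connected vertex set [X], with steps
    allowed to use walks of the whole graph.  Let [C] be the component of [b] in
    [X - a] and [A = X - C]; both are connected and all edges between them
    meet [a].  A Hamiltonian path of [A] from [a] to some [a'] is glued to one of
    [C] from some [c'] to [b]; one can take [a'] adjacent to [a] unless [A = {a}].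
    - If [a] and [b] are adjacent, [c'] can be taken adjacent to [b], and
      a step of length 4 from [a'] to [c'] exists as soon as [a'] (or [c']) can
      be moved to the end of a walk of length 2; when neither can, [A] and [C]
      are stars, and either [a] has a second neighbour in [C], which serves as
      [c'], or [X] is a bistar.
    - Otherwise let [c] be a neighbour of [a] in [C].  Take [c' = c], unless [C] is a
      bistar centered at [c] and [b]: then take for [c'] a leaf of [c] if [A = {a}],
      and else visit, after [A], the leaves of [b] (joined to [a'] by walks of length 4),
      then [c], the leaves of [c], and [b].
    Conversely, in a bistar centered at [a] and [b] colour the vertices by
    adjacency to [a]; steps avoiding [a] and [b] preserve the colour, so no such path
    visits both the leaves of [a] and those of [b] between [a] and [b]. *)
Require Import Defs.
From mathcomp Require Import all_boot.

Set Implicit Arguments.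
Unset Strict Implicit.
Unset Printing Implicit Defensive.

Lemma connect_ind (T : finType) (r : rel T) (P : T -> Prop) x :
    P x -> (forall y z, connect r x y -> r y z -> P y -> P z) ->
  forall y, connect r x y -> P y.
Proof.
move=> Px Pstep y /connectP[p + ->]; elim/last_ind: p => [|p z IHp] //.
rewrite rcons_path last_rcons => /andP[xp pz].
by apply: Pstep pz (IHp xp); apply/connectP; exists p.
Qed.

Section Graph.
Variables (T : finType) (e : rel T).
Hypotheses (e_sym : symmetric e) (e_irr : irreflexive e).
Implicit Types (X A C D : {set T}) (a b c r x y z : T).

(** * Steps of length 1, 2 or 4 as a relation *)

Definition walk2 : rel T := fun x y => [exists z, e x z && e z y].

(** Length 4 is split into two walks of length 2: gluing provides the halves separately, and the
    colouring argument treats them one at a time. *)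
Definition step124 : rel T :=
  fun x y => [|| e x y, walk2 x y | [exists z, walk2 x z && walk2 z y]].

Lemma walk2I z x y : e x z -> e z y -> walk2 x y.
Proof. by move=> xz zy; apply/existsP; exists z; rewrite xz. Qed.

Lemma walk2_step124 x y : walk2 x y -> step124 x y.
Proof. by rewrite /step124 => ->; rewrite orbT. Qed.

Lemma walk4_step124 z x y : walk2 x z -> walk2 z y -> step124 x y.
Proof.
by move=> xz zy; apply/or3P/Or33/existsP; exists z; rewrite xz.
Qed.

Lemma walk2_sym : symmetric walk2.
Proof.
by move=> x y; apply: eq_existsb => z; rewrite andbC e_sym (e_sym x).
Qed.

Lemma step124_sym : symmetric step124.
Proof.
move=> x y; rewrite /step124 e_sym walk2_sym; congr [|| _, _ | _].
by apply: eq_existsb => z; rewrite andbC walk2_sym (walk2_sym x).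
Qed.

Lemma step124P x y :
  reflect (exists2 k, k \in pred3 1 2 4 & walk e k x y) (step124 x y).
Proof.
apply: (iffP or3P) => [[xy | | ] | [k]].
- by exists 1 => //; exists [:: y]; rewrite /= xy.
- case/existsP=> z /andP[xz zy].
  by exists 2 => //; exists [:: z; y]; rewrite /= xz zy.
- case/existsP=> z /andP[/existsP[u /andP[xu uz]] /existsP[w /andP[zw wy]]].
  by exists 4 => //; exists [:: u; z; w; y]; rewrite /= xu uz zw wy.
rewrite !inE => /or3P[] /eqP-> [p []].
- by case: p => [|z []] //= _ /andP[xz _] <-; apply: Or31.
- case: p => [|z [|w []]] //= _ /and3P[xz zw _] <-.
  by apply: Or32; apply: walk2I xz zw.
case: p => [|z1 [|z2 [|z3 [|z4 []]]]] //= _ /and5P[e1 e2 e3 e4 _] <-.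
apply/Or33/existsP; exists z2.
by rewrite (walk2I e1 e2) (walk2I e3 e4).
Qed.

Lemma hamiltonian_pathE x p :
  hamiltonian_path e (pred3 1 2 4) x p <->
  [/\ uniq (x :: p), forall v, v \in x :: p & path step124 x p].
Proof.
split=> [] [Up allp stepp]; split=> //.
  by apply/(pathP x) => i /stepp ?; apply/step124P.
by move=> i lt_i; apply/step124P; move/(pathP x): stepp; apply.
Qed.

(** * Hamiltonian paths of a vertex set *)

Definition hpath X a b : Prop :=
  exists p, [/\ uniq (a :: p), a :: p =i X, path step124 a p & last a p = b].

Lemma hpath1 a : hpath [set a] a a.
Proof. by exists [::]; split=> // x; rewrite !inE. Qed.

Lemma hpath_rev X a b : hpath X a b -> hpath X b a.
Proof.
case=> p [Up Xp pathp <-]; exists (rev (belast a p)).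
have Er: last a p :: rev (belast a p) = rev (a :: p).
  by rewrite (lastI a) rev_rcons.
split; first by rewrite Er rev_uniq.
- by move=> x; rewrite Er mem_rev Xp.
- by rewrite rev_path (eq_path (e' := step124)) // => x y; rewrite step124_sym.
by case: p {Up Xp pathp} Er => //= x p _; rewrite rev_cons last_rcons.
Qed.

Lemma hpath_cat A C a x y b :
    hpath A a x -> step124 x y -> hpath C y b -> [disjoint A & C] ->
  hpath (A :|: C) a b.
Proof.
case=> p [Up Ap pathp <-] xy [q [Uq Cq pathq <-]] dAC.
exists (p ++ y :: q); split; last by rewrite last_cat.
- rewrite -cat_cons cat_uniq Up Uq andbT; apply/hasPn => z.
  by rewrite Cq => Cz; rewrite Ap (disjointFl dAC).
- by move=> z; rewrite -cat_cons mem_cat Ap Cq inE.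
by rewrite cat_path /= pathp xy.
Qed.

(** Any enumeration of [X] will do, as consecutive vertices are joined through [r]. This serves to
    traverse the leaves of a centre. *)
Lemma hpath_common_nbr X r x :
    x \in X -> {in X, forall y, e r y} ->
  exists y z, [/\ y \in X, z \in X & hpath X y z].
Proof.
move=> Xx Xr.
have memX := mem_enum X; have := enum_uniq X.
case: (enum X) memX => [|y s] memX Us; first by rewrite -memX in Xx.
exists y, (last y s); split; [by rewrite -memX mem_head| |].
  by rewrite -memX mem_last.
exists s; split=> //; apply/(pathP r) => i lt_i.
apply: walk2_step124; apply: (walk2I (z := r)); rewrite ?[e _ r]e_sym Xr //.
  by rewrite -memX mem_nth // ltnW.
by rewrite -memX inE mem_nth ?orbT.
Qed.

(** * Connected vertex sets and components *)

Definition induced X : rel T := fun x y => [&& x \in X, y \in X & e x y].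

Definition connected_in X := {in X &, forall x y, connect (induced X) x y}.

Lemma induced_sym X : symmetric (induced X).
Proof. by move=> x y; rewrite /induced e_sym andbCA. Qed.

Lemma connected_from X r :
  {in X, forall x, connect (induced X) r x} -> connected_in X.
Proof.
move=> connX x y Xx Xy; apply: connect_trans (connX y Xy).
by rewrite (sym_connect_sym (@induced_sym X)) connX.
Qed.

Lemma connected_in_ind X r (P : T -> Prop) :
    connected_in X -> r \in X -> P r ->
    {in X &, forall x y, e x y -> P x -> P y} ->
  {in X, forall x, P x}.
Proof.
move=> connX Xr Pr Pstep x Xx.
apply: (connect_ind Pr) (connX _ _ Xr Xx) => y z _ /and3P[Xy Xz yz].
exact: Pstep.
Qed.

Lemma connected_in_nbr X r x :
    connected_in X -> r \in X -> x \in X -> x != r ->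
  exists2 y, y \in X & e r y.
Proof.
move=> connX Xr Xx xNr; apply/exists_inP; case: exists_inP => // no.
(* Without such a neighbour, being equal to [r] propagates along the edges of [X]. *)
case/eqP: xNr; move: x Xx; apply: (connected_in_ind connX Xr) => //.
by move=> y z _ Xz yz yr; case: no; exists z; rewrite -?yr.
Qed.

Lemma star_connected X r :
  r \in X -> {in X, forall x, x != r -> e r x} -> connected_in X.
Proof.
move=> Xr starX; apply: (connected_from (r := r)) => x Xx.
have [->|xNr] := eqVneq x r; first exact: connect0.
by apply: connect1; rewrite /induced Xr Xx starX.
Qed.

Definition component X b : {set T} := [set x | connect (induced X) b x].

Lemma component_sub X b : b \in X -> component X b \subset X.
Proof.
move=> Xb; apply/subsetP=> x; rewrite inE.
by move: x; apply: connect_ind => // y z _ /and3P[].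
Qed.

Lemma component_closed X b x y :
  x \in X -> y \in X -> e x y -> x \in component X b -> y \in component X b.
Proof.
move=> Xx Xy xy; rewrite !inE => bx; apply: connect_trans bx _.
by apply: connect1; apply/and3P.
Qed.

Lemma component_connected X b : connected_in (component X b).
Proof.
apply: (connected_from (r := b)) => x; rewrite inE.
move: x; apply: connect_ind => [|y z by_ yz IHy]; first exact: connect0.
apply: connect_trans IHy _; apply: connect1.
have /and3P[Xy Xz e_yz] := yz.
by rewrite /induced !inE by_ (connect_trans by_ (connect1 yz)).
Qed.

Lemma component_compl_connected X a b :
    connected_in X -> a \in X -> b \in X -> b != a ->
  connected_in (X :\: component (X :\ a) b).
Proof.
move=> connX Xa Xb bNa; set C := component _ b; set A := X :\: C.
have CX : C \subset X :\ a by rewrite component_sub // !inE bNa.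
have Aa : a \in A.
  rewrite inE Xa andbT; apply/negP => /(subsetP CX).
  by rewrite !inE eqxx.
apply: (connected_from (r := a)) => x /setDP[Xx].
(* The disjunction is invariant along the edges of [X], because an edge avoiding [a] cannot leave
   the component [C]. *)
suff: x \in C \/ connect (induced A) a x by case=> [->|].
move: x Xx; apply: (connected_in_ind connX Xa); first by right; apply: connect0.
move=> x y Xx Xy xy IHx.
have [-> | yNa] := eqVneq y a; first by right; apply: connect0.
have [Cy | CNy] := boolP (y \in C); first by left.
case: IHx => [Cx | ax]; right.
  have /setD1P[xNa _] := subsetP CX _ Cx.
  by rewrite (component_closed _ _ xy Cx) ?inE ?xNa ?yNa in CNy.
have [Cx | CNx] := boolP (x \in C).
  have /setD1P[xNa _] := subsetP CX _ Cx.
  by rewrite (component_closed _ _ xy Cx) ?inE ?xNa ?yNa in CNy.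
apply: connect_trans ax _; apply: connect1.
by rewrite /induced !in_setD CNx CNy Xx Xy.
Qed.

(** * Bistars in induced subgraphs *)

Definition bistar_in X a b :=
  [&& e a b,
      [forall v in X, (v != a) ==> (v != b) ==>
         (e v a (+) e v b) &&
         [forall w in X, e v w ==> (w == a) || (w == b)]],
      [exists u in X, (u != b) && e a u] &
      [exists u in X, (u != a) && e b u]].

Lemma bistar_inP X a b :
  reflect
    [/\ e a b,
        {in X, forall v, v != a -> v != b ->
          e v a (+) e v b /\ {in X, forall w, e v w -> w = a \/ w = b}},
        exists u, [/\ u \in X, u != b & e a u] &
        exists u, [/\ u \in X, u != a & e b u]]
    (bistar_in X a b).
Proof.
apply: (iffP and4P) => -[ab leaves La Lb]; split=> //.
- move=> v Xv va vb; have := forall_inP leaves v Xv.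
  rewrite va vb => /andP[-> /forall_inP Hw]; split=> // w Xw vw.
  have := Hw w Xw; rewrite vw => /orP[] /eqP; by [left|right].
- by have /exists_inP[u Xu /andP[]] := La; exists u.
- by have /exists_inP[u Xu /andP[]] := Lb; exists u.
- apply/forall_inP=> v Xv; apply/implyP=> va; apply/implyP=> vb.
  have [-> Hw] := leaves v Xv va vb; apply/forall_inP=> w Xw.
  by apply/implyP=> vw; have [->|->] := Hw w Xw vw; rewrite eqxx ?orbT.
- by have [u [Xu ub au]] := La; apply/exists_inP; exists u => //; apply/andP.
by have [u [Xu ub au]] := Lb; apply/exists_inP; exists u => //; apply/andP.
Qed.

Lemma edge_neq x y : e x y -> x != y.
Proof. by apply: contraTneq => ->; rewrite e_irr. Qed.

(** The vertex [u] violates the exclusive or. *)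
Lemma common_nbr_not_bistar X a b u :
  u \in X -> e a u -> e u b -> ~~ bistar_in X a b.
Proof.
move=> Xu au ub; apply/bistar_inP => -[_ /(_ u Xu) leaf _ _].
have [] := leaf _ _; rewrite ?(edge_neq ub) 1?eq_sym ?(edge_neq au) //.
by rewrite ub e_sym au.
Qed.

(** The centre [b] would have degree at most 1 in [X]. *)
Lemma leaf_not_bistar X a b :
  {in X, forall x, e b x -> x = a} -> ~~ bistar_in X a b.
Proof.
move=> leafb; apply/bistar_inP => -[_ _ _ [u [Xu /eqP ua bu]]].
exact: ua (leafb u Xu bu).
Qed.

(* A bistar has leaves at [r], so one of them replaces a forbidden neighbour. *)
Lemma hpath_nbr X r :
    (forall s, s \in X -> r != s -> ~~ bistar_in X r s -> hpath X r s) ->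
    connected_in X -> r \in X -> X != [set r] ->
  exists s, [/\ s \in X, e r s & hpath X r s].
Proof.
move=> hpX connX Xr XN1.
have [x Xx xNr] : exists2 x, x \in X & x != r.
  apply/exists_inP; apply: contraNT XN1 => /exists_inPn all_r.
  apply/eqP/setP=> y; rewrite inE; apply/idP/eqP => [Xy | -> //].
  by apply/eqP; rewrite -[_ == _]negbK all_r.
have [s Xs rs] := connected_in_nbr connX Xr Xx xNr.
have [|NB] := boolP (bistar_in X r s); last first.
  by exists s; split=> //; apply: hpX; rewrite ?edge_neq.
case/bistar_inP=> _ leaves [u [Xu us ru]] _; exists u; split=> //.
have ur : u != r by rewrite eq_sym edge_neq.
apply: hpX => //; first by rewrite eq_sym.
have [xor_u nbr_u] := leaves u Xu ur us.
apply: leaf_not_bistar => w Xw uw; have [//|ws] := nbr_u w Xw uw.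
by move: xor_u; rewrite -ws uw e_sym ru.
Qed.

(** Being [r] or a neighbour of [r] propagates along the edges of [X]: from a neighbour of [r] one
    can only return to [r]. *)
Lemma star_of_no_walk2 X r :
    connected_in X -> r \in X ->
    (forall x y, x \in X -> y \in X -> e r x -> e x y -> y = r) ->
  {in X, forall x, x != r -> e r x}.
Proof.
move=> connX Xr no_walk2 x Xx xNr.
suff [xr | //]: x = r \/ e r x by rewrite xr eqxx in xNr.
move: x Xx {xNr}; apply: (connected_in_ind connX Xr); first by left.
move=> x y Xx Xy xy [<- | rx]; [by right | left].
exact: no_walk2 rx xy.
Qed.

Lemma bistar_in_sym X a b : bistar_in X a b = bistar_in X b a.
Proof.
have sub x y : bistar_in X x y -> bistar_in X y x.
  case/bistar_inP=> xy leaves Lx Ly; apply/bistar_inP; split=> //.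
    by rewrite e_sym.
  move=> v Xv vy vx; have [xor_v nbr_v] := leaves v Xv vx vy.
  split; first by rewrite addbC.
  by move=> w Xw /nbr_v[] // ->; [right | left].
by apply/idP/idP; apply: sub.
Qed.

(** * Sufficiency: gluing paths and induction *)

Lemma hpath_adjacent_glue A C a b :
    connected_in A -> connected_in C -> [disjoint A & C] ->
    a \in A -> b \in C -> e a b ->
    {in A & C, forall x y, e x y -> x = a} ->
    (forall s, s \in A -> a != s -> ~~ bistar_in A a s -> hpath A a s) ->
    (forall s, s \in C -> b != s -> ~~ bistar_in C b s -> hpath C b s) ->
    ~~ bistar_in (A :|: C) a b ->
  hpath (A :|: C) a b.
Proof.
move=> connA connC dAC Aa Cb ab cutAC hpA hpC NB.
have ba : e b a by rewrite e_sym.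
(* If one side is a single vertex, the edge between [a] and [b] yields a connecting walk of length 1
   or 2. *)
have [A1 | AN1] := eqVneq A [set a]; have [C1 | CN1] := eqVneq C [set b].
- move: dAC; rewrite A1 C1; apply: hpath_cat (hpath1 a) _ (hpath1 b).
  by rewrite /step124 ab.
- have [b1 [Cb1 bb1 hpb1]] := hpath_nbr hpC connC Cb CN1.
  move: dAC; rewrite A1; apply: hpath_cat (hpath1 a) _ (hpath_rev hpb1).
  exact: walk2_step124 (walk2I ab bb1).
- have [a1 [Aa1 aa1 hpa1]] := hpath_nbr hpA connA Aa AN1.
  move: dAC; rewrite C1; apply: hpath_cat hpa1 _ (hpath1 b).
  by apply: walk2_step124 (walk2I _ ab); rewrite e_sym.
have [a1 [Aa1 aa1 hpa1]] := hpath_nbr hpA connA Aa AN1.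
have [b1 [Cb1 bb1 hpb1]] := hpath_nbr hpC connC Cb CN1.
(* The common neighbour [x] lets the path of [A] end at [y]; the connecting walk is then
   [y, x, a, b, b1]. *)
have [/exists_inP[x Ax /exists_inP[y Ay /and3P[ax xy yNa]]] | far_a] :=
  boolP [exists x in A, [exists y in A, [&& e a x, e x y & y != a]]].
  have hpy : hpath A a y.
    by apply: hpA; rewrite 1?eq_sym // (common_nbr_not_bistar Ax).
  apply: hpath_cat hpy _ (hpath_rev hpb1) dAC.
  apply: walk4_step124 (walk2I ab bb1).
  by apply: (walk2I (z := x)); rewrite e_sym.
(* Symmetrically, the connecting walk is [a1, a, b, x, y]. *)
have [/exists_inP[x Cx /exists_inP[y Cy /and3P[bx xy yNb]]] | far_b] :=
  boolP [exists x in C, [exists y in C, [&& e b x, e x y & y != b]]].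
  have hpy : hpath C b y.
    by apply: hpC; rewrite 1?eq_sym // (common_nbr_not_bistar Cx).
  apply: hpath_cat hpa1 _ (hpath_rev hpy) dAC.
  by apply: walk4_step124 (walk2I bx xy); apply: walk2I ab; rewrite e_sym.
have no_walk2A x y : x \in A -> y \in A -> e a x -> e x y -> y = a.
  move=> Ax Ay ax xy; apply: contraNeq far_a => yNa.
  by apply/exists_inP; exists x => //; apply/exists_inP; exists y; rewrite ?ax ?xy.
have no_walk2C x y : x \in C -> y \in C -> e b x -> e x y -> y = b.
  move=> Cx Cy bx xy; apply: contraNeq far_b => yNb.
  by apply/exists_inP; exists x => //; apply/exists_inP; exists y; rewrite ?bx ?xy.
have starA := star_of_no_walk2 connA Aa no_walk2A.
have starC := star_of_no_walk2 connC Cb no_walk2C.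
(* Both sides are now stars. In [C] the vertex [w] is a leaf, so a path between [b] and [w] exists,
   and [a1, a, w] is the connecting walk. *)
have [/exists_inP[w Cw /andP[wNb aw]] | no_aC] :=
  boolP [exists w in C, (w != b) && e a w].
  have hpw : hpath C b w.
    apply: hpC; rewrite 1?eq_sym //; apply: leaf_not_bistar => x Cx wx.
    exact: no_walk2C (starC w Cw wNb) wx.
  apply: hpath_cat hpa1 _ (hpath_rev hpw) dAC.
  by apply: walk2_step124 (walk2I _ aw); rewrite e_sym.
have aC w : w \in C -> e a w -> w = b.
  move=> Cw aw; apply: contraNeq no_aC => wNb.
  by apply/exists_inP; exists w => //; apply/andP.
have disj x : x \in A -> x \in C -> False by move=> Ax; rewrite (disjointFr dAC Ax).
(* The two stars, joined only by the edge between [a] and [b], form a bistar; [a1] and [b1] witness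
   the degrees. *)
case/bistar_inP: NB; split=> //; last 2 first.
- exists a1; split; rewrite ?inE ?Aa1 //.
  by apply: contraTneq Aa1 => ->; apply/negP=> /disj; apply.
- exists b1; split; rewrite ?inE ?Cb1 ?orbT //.
  by apply: contraTneq Cb1 => ->; apply/negP/disj.
move=> v /setUP[Av | Cv] va vb.
  have av := starA v Av va; split.
    rewrite e_sym av; apply/negP => vb'.
    by rewrite (cutAC _ _ Av Cb vb') eqxx in va.
  move=> w /setUP[Aw | Cw] vw; left; first exact: no_walk2A av vw.
  by rewrite (cutAC _ _ Av Cw vw) eqxx in va.
have bv := starC v Cv vb; split.
  rewrite (e_sym v b) bv addbT e_sym; apply/negP => av.
  by rewrite (aC v Cv av) eqxx in vb.
move=> w /setUP[Aw | Cw] vw; [left | right; exact: no_walk2C bv vw].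
by apply: cutAC Aw Cv _; rewrite e_sym.
Qed.

(** The last hypothesis, an instance of the induction hypothesis, ranges over subsets of [C] because
    it is applied to [C] without the leaves of [b]. *)
Lemma hpath_bistar_tail A C a b c :
    [disjoint A & C] -> e a c -> bistar_in C c b -> c \in C -> b \in C ->
    (exists s, [/\ s \in A, e a s & hpath A a s]) ->
    (forall D : {set T}, D \subset C -> connected_in D -> c \in D -> b \in D ->
       c != b -> ~~ bistar_in D c b -> hpath D c b) ->
  hpath (A :|: C) a b.
Proof.
move=> dAC ac /bistar_inP[cb leaves _ [b1 [Cb1 b1c bb1]]] Cc Cb.
case=> a1 [Aa1 aa1 hpa1] hpD.
have bc : e b c by rewrite e_sym.
have cNb := edge_neq cb.
pose L := [set v in C | (v != c) && e b v].
pose D := [set v in C | (v == c) || e v c].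
have CLD : C = L :|: D.
  apply/setP=> v; rewrite !inE -andb_orr; case Cv: (v \in C) => //=.
  have [_ | vc] //= := eqVneq v c; have [-> | vb] := eqVneq v b.
    by rewrite bc orbT.
  have [] := leaves v Cv vc vb; rewrite (e_sym b) /=.
  by case: (e v c); case: (e v b).
have disj v : v \in L -> v \in D -> False.
  rewrite !inE => /and3P[Cv vc bv] /andP[_ /orP[/eqP vc' | vc']].
    by rewrite vc' eqxx in vc.
  have vb : v != b by rewrite eq_sym edge_neq.
  by have [] := leaves v Cv vc vb; rewrite vc' e_sym bv.
have hpDcb : hpath D c b.
  apply: hpD; rewrite ?inE ?Cc ?Cb ?eqxx ?bc ?orbT //.
  - by apply/subsetP=> v; rewrite inE => /andP[].
  - apply: (star_connected (r := c)); first by rewrite inE Cc eqxx.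
    by move=> v; rewrite inE => /andP[_ /predU1P[-> /eqP // | vc _]]; rewrite e_sym.
  (* Deprived of its leaves, [b] keeps only the neighbour [c] in [D]. *)
  apply: leaf_not_bistar => v Dv bv; have [//|vc] := eqVneq v c.
  case: (disj v _ Dv); rewrite inE vc bv !andbT.
  by move: Dv; rewrite inE => /andP[].
have Lb1 : b1 \in L by rewrite inE Cb1 b1c.
have bL : {in L, forall v, e b v} by move=> v; rewrite inE => /and3P[].
have [y [z [Ly Lz hpyz]]] := hpath_common_nbr Lb1 bL.
have hpC : hpath C y b.
  rewrite CLD; apply: hpath_cat hpyz _ hpDcb _.
    by apply: walk2_step124 (walk2I _ bc); rewrite e_sym bL.
  by apply/pred0P=> v /=; apply/negP => /andP[]; apply: disj.
apply: hpath_cat hpa1 _ hpC dAC.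
(* The walk is [a1, a, c, b, y]. *)
apply: (walk4_step124 (z := c)); last exact: walk2I cb (bL y Ly).
by apply: walk2I ac; rewrite e_sym.
Qed.

Lemma hpath_not_bistar X a b :
    connected_in X -> a \in X -> b \in X -> a != b -> ~~ bistar_in X a b ->
  hpath X a b.
Proof.
have [n] := ubnP #|X|; elim: n X a b => // n IHn X a b ltXn connX Xa Xb aNb NB.
have bNa : b != a by rewrite eq_sym.
pose C := component (X :\ a) b; pose A := X :\: C.
have Xab : b \in X :\ a by rewrite !inE bNa.
have CXa : C \subset X :\ a by apply: component_sub.
have CX := subset_trans CXa (subD1set X a).
have Cb : b \in C by rewrite inE connect0.
have aNC : a \notin C.
  by apply/negP => /(subsetP CXa); rewrite setD11.
have Aa : a \in A by rewrite inE aNC.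
have dAC : [disjoint A & C].
  by apply/pred0P => x /=; rewrite inE; case: (x \in C); rewrite ?andbF.
have XAC : X = A :|: C.
  by rewrite setUC -{1}(setID X C) (setIidPr CX).
have properP D x : D \subset X -> x \in X -> x \notin D -> #|D| < n.
  move=> DX Xx xND; rewrite ltnS in ltXn; apply: leq_trans ltXn.
  by apply: proper_card; rewrite properE DX; apply/subsetPn; exists x.
have ltAn : #|A| < n.
  by apply: (properP A b); rewrite ?subsetDl // inE Cb.
have ltCn : #|C| < n by apply: properP CX Xa aNC.
have connA : connected_in A by apply: component_compl_connected.
have connC : connected_in C by apply: component_connected.
(* Otherwise the edge would lie in [X :\ a] and pull [x] into the component [C]. *)
have cutAC : {in A & C, forall x y, e x y -> x = a}.
  move=> x y /setDP[Xx xNC] Cy xy; apply: contraNeq xNC => xNa.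
  by apply: component_closed (subsetP CXa _ Cy) _ _ Cy; rewrite ?inE ?xNa // e_sym.
have hpA s : s \in A -> a != s -> ~~ bistar_in A a s -> hpath A a s.
  by move=> As; apply: IHn.
have [ab | abN] := boolP (e a b).
  rewrite XAC; apply: hpath_adjacent_glue => //; last by rewrite -XAC.
  by move=> s Cs; apply: IHn.
(* Otherwise membership in [A] would propagate along the edges of [X] and reach [b]. *)
have [c Cc ac] : exists2 c, c \in C & e a c.
  apply/exists_inP; apply: contraT => /exists_inPn no_c.
  have: b \in A.
    apply: (connected_in_ind (P := fun x => x \in A) connX Xa) Xb => // x y _ Xy xy Ax.
    rewrite inE Xy andbT; apply/negP => Cy.
    by have := no_c y Cy; rewrite -(cutAC x y Ax Cy xy) xy.
  by rewrite inE Cb.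
have cNb : c != b by apply: contraNneq abN => <-.
rewrite XAC.
have [A1 | AN1] := eqVneq A [set a].
  have [Bcb | NBcb] := boolP (bistar_in C c b); last first.
    move: dAC; rewrite A1; apply: hpath_cat (hpath1 a) _ (IHn C c b _ _ _ _ _ _) => //.
    by rewrite /step124 ac.
  have /bistar_inP[cb _ [u [Cu ub cu]] _] := Bcb.
  (* The vertices [u] and [b] share the neighbour [c], so they are not the centres of a bistar. *)
  have hpu : hpath C u b.
    by apply: IHn => //; apply: (common_nbr_not_bistar Cc) cb; rewrite e_sym.
  move: dAC; rewrite A1; apply: hpath_cat (hpath1 a) _ hpu.
  exact: walk2_step124 (walk2I ac cu).
have [a1 [Aa1 aa1 hpa1]] := hpath_nbr hpA connA Aa AN1.
have [Bcb | NBcb] := boolP (bistar_in C c b).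
  apply: hpath_bistar_tail ac Bcb Cc Cb _ _ => //; first by exists a1.
  by move=> D DC; apply: IHn; apply: leq_ltn_trans (subset_leq_card DC) ltCn.
apply: hpath_cat hpa1 _ (IHn C c b _ _ _ _ _ _) dAC => //.
by apply: walk2_step124 (walk2I _ ac); rewrite e_sym.
Qed.

(** * Necessity: bistars admit no such path *)

Lemma bistar_in_setT a b : bistar e a b <-> bistar_in [set: T] a b.
Proof.
have degP x y : e x y -> 2 <= deg e x <-> exists u, [/\ u \in setT, u != y & e x u].
  (* The neighbour [y] accounts for one unit of the degree. *)
  move=> xy; rewrite /deg (cardsD1 y) inE xy ltnS card_gt0.
  split=> [/set0Pn[u] | [u [_ uy xu]]]; last first.
    by apply/set0Pn; exists u; rewrite !inE uy.
  by rewrite !inE => /andP[uy xu]; exists u.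
split=> [[ab leaves da db] | /bistar_inP[ab leaves La Lb]].
  apply/bistar_inP; split=> //; last 2 first.
  - exact/(degP _ _ ab).
  - by apply/(degP b a); rewrite // e_sym.
  by move=> v _ va vb; have [xor_v nbr_v] := leaves v va vb; split=> // w _ /nbr_v.
split=> //; last 2 first.
- exact/(degP _ _ ab).
- by apply/(degP b a); rewrite // e_sym.
move=> v va vb; have [xor_v nbr_v] := leaves v (in_setT v) va vb; split=> // w.
exact: nbr_v.
Qed.

(** A bistar is bipartite, with the neighbours of [a] as one class: each edge flips the colour
    [e a x], so two edges restore it. *)
Lemma bistar_walk2 a b x y : bistar e a b -> walk2 x y -> e a x = e a y.
Proof.
case=> ab leaves _ _.
have flip u v : e u v -> e a v = ~~ e a u.
  have half z w : z != a -> z != b -> e z w -> e a w = ~~ e a z.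
    move=> za zb zw; have [xor_z nbr_z] := leaves z za zb.
    move: xor_z; rewrite (e_sym a z); have [wa | wb] := nbr_z w zw.
      by move: zw; rewrite wa e_irr => ->.
    by move: zw; rewrite wb ab => ->; case: (e z a).
  move=> uv; have [ua | ua] := eqVneq u a; first by rewrite -ua uv e_irr.
  have [va | va] := eqVneq v a; first by move: uv; rewrite va e_irr e_sym => ->.
  have [ub | ub] := eqVneq u b; last exact: half uv.
  have vb : v != b by rewrite -ub eq_sym edge_neq.
  by rewrite (half v u) ?negbK // e_sym.
by case/existsP=> z /andP[/flip xz /flip ->]; rewrite xz negbK.
Qed.

Lemma bistar_no_hpath a b : a != b -> bistar e a b -> ~ hpath setT a b.
Proof.
move=> aNb bistar_ab [p [Up Tp pathp lastp]].
have /bistar_in_setT/bistar_inP[ab leaves [u [_ ub au]] [w [_ wa bw]]] := bistar_ab.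
have ua : u != a by rewrite eq_sym edge_neq.
have wb : w != b by rewrite eq_sym edge_neq.
case/lastP: p => [|p z] in Up Tp pathp lastp; first by case/eqP: aNb.
rewrite last_rcons in lastp; rewrite lastp in Up Tp pathp => {z lastp}.
have mid x : x != a -> x != b -> x \in p.
  by move=> xa xb; have := Tp x; rewrite !inE mem_rcons inE (negPf xa) (negPf xb).
have [pa pb] : a \notin p /\ b \notin p.
  move: Up; rewrite /= mem_rcons inE rcons_uniq negb_or.
  by case/andP=> /andP[_ ->] /andP[->].
(* A step of length 1 would lead from a leaf to a centre, and [p] contains no centre; lengths 2 and
   4 preserve the colour. *)
have same_color x y : x \in p -> y \in p -> step124 x y -> e a x == e a y.
  move=> px py /or3P[xy | /(bistar_walk2 bistar_ab)-> // | /existsP[z]].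
    have xa : x != a by apply: contraTneq px => ->.
    have xb : x != b by apply: contraTneq px => ->.
    have [_ nbr_x] := leaves x (in_setT x) xa xb.
    by have [yE | yE] := nbr_x y (in_setT y) xy; rewrite yE ?(negPf pa) ?(negPf pb) in py.
  by case/andP=> /(bistar_walk2 bistar_ab)-> /(bistar_walk2 bistar_ab)->.
have pathp' : path step124 a p by move: pathp; rewrite rcons_path => /andP[].
case: p => [|x p] in mid pa pb same_color pathp' {Up Tp pathp}.
  by have := mid u ua ub.
have color : {in x :: p, forall y, e a x == e a y}.
  case/andP: pathp' => _ pathp.
  have pathc : path [rel y z | e a y == e a z] x p.
    apply: (sub_in_path (P := mem (x :: p))) pathp; last exact/allP.
    by move=> y z; apply: same_color.
  have tr : transitive [rel y z | e a y == e a z].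
    by move=> y1 y2 y3 /= /eqP->.
  move=> y /predU1P[-> // | py].
  exact: allP (order_path_min tr pathc) y py.
(* Both leaves lie on the monochromatic path, yet [u] is adjacent to [a] and [w] is not. *)
have [] := leaves w (in_setT w) wa wb; rewrite (e_sym w b) bw e_sym.
by rewrite -(eqP (color w (mid w wa wb))) (eqP (color u (mid u ua ub))) au.
Qed.

Lemma hpathP a b :
  has_hamiltonian_path e (pred3 1 2 4) a b <-> hpath setT a b.
Proof.
split=> [[p /hamiltonian_pathE[Up allp stepp] lastp] | [p [Up Tp stepp lastp]]].
  by exists p; split=> // x; rewrite allp inE.
by exists p => //; apply/hamiltonian_pathE; split=> // x; rewrite Tp inE.
Qed.

End Graph.

Theorem theorem18 (T : finType) (e : rel T)
  (e_sym : symmetric e) (e_irr : irreflexive e)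
  (e_conn : connected_graph e) (a b : T) (a_neq_b : a != b) :
  has_hamiltonian_path e (pred3 1 2 4) a b <-> ~ bistar e a b.
Proof.
split=> [/hpathP hp_ab bistar_ab | NB].
  exact: (bistar_no_hpath e_sym e_irr a_neq_b bistar_ab hp_ab).
apply/hpathP; apply: hpath_not_bistar => //; last first.
  by apply/negP=> /(bistar_in_setT e_sym).
move=> x y _ _; rewrite (eq_connect (e' := e)) //.
by move=> u v; rewrite /induced !inE.
Qed.
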